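(* Let $0<\delta<\pi$, let $\beta>0$, and let $(\lambda_0,\lambda_1,\lambda_2,\lambda_3)=(0,0,-i\beta,i\beta)$. Then $$R_{j,j-1}+R_{j,j+1}\le\frac{\sin\delta-\delta}{\delta\cos\delta-\sin\delta}\,R_{j,j}<R_{j,j},\qquad j=2,\dots,n-1,$$ for all $n\ge3$ and all $t_1<\dots<t_n$ such that $\beta(t_{j+1}-t_j)\le\delta$ for $j=1,\dots,n-1$.
   Context: For $(\mu_0,\dots,\mu_N)\in\mathbb{C}^{N+1}$ let $\Phi_{(\mu_0,\dots,\mu_N)}$ (the fundamental function) be the unique solution of $\prod_{j=0}^N(\frac{d}{dx}-\mu_j)\Phi=0$ on $\mathbb{R}$ with $\Phi^{(k)}(0)=0$ for $k=0,\dots,N-1$ and $\Phi^{(N)}(0)=1$. Define, where the denominators do not vanish, $$\rho(x)=\frac{\Phi'_{(\lambda_0,\dots,\lambda_3)}(x)\Phi_{(\lambda_0,\lambda_1)}(x)-\Phi_{(\lambda_0,\dots,\lambda_3)}(x)\Phi'_{(\lambda_0,\lambda_1)}(x)}{\Phi_{(\lambda_0,\lambda_1)}(x)\Phi_{(\lambda_2,\lambda_3)}(x)},\qquad \sigma(x)=\frac{\Phi_{(\lambda_0,\dots,\lambda_3)}(x)}{\Phi_{(\lambda_0,\lambda_1)}(x)\Phi_{(\lambda_2,\lambda_3)}(x)}.$$ For $t_1<\dots<t_n$ and $j=2,\dots,n-1$ the entries of the tridiagonal matrix $R$ are $$R_{j,j}=\rho(t_j-t_{j-1})-\rho(-(t_{j+1}-t_j)),\quad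 R_{j,j+1}=\sigma(t_{j+1}-t_j),\quad R_{j,j-1}=-\sigma(-(t_j-t_{j-1})).$$ (The $(n-2)\times(n-2)$ matrix is $R=(R_{i,j})_{2\le i,j\le n-1}$; the numbers $R_{2,1}$ and $R_{n-1,n}$ are also defined by these formulas.) *)

(* Defs.v *)
From Stdlib Require Import Reals List Arith ClassicalEpsilon.
From Coquelicot Require Import Coquelicot.
Import ListNotations.
Open Scope R_scope.

(* Derivative of a complex-valued function of a real variable. Like
   [Derive], it is total; it is meaningful only where [f] is differentiable. *)
Definition CDerive (f : R -> C) (x : R) : C :=
  (Derive (fun y => Re (f y)) x, Derive (fun y => Im (f y)) x).

Definition CDerive_n (k : nat) (f : R -> C) : R -> C := Nat.iter k CDerive f.

(* [diff_op [mu_0; ...; mu_N] f] is prod_j (d/dx - mu_j) f; the factors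
   commute on smooth functions. *)
Fixpoint diff_op (mus : list C) (f : R -> C) : R -> C :=
  match mus with
  | nil => f
  | mu :: l => diff_op l (fun x => (CDerive f x - mu * f x)%C)
  end.

(* For a list of length N + 1: [f] is N + 1 times differentiable on R (first
   clause), solves the equation and has the prescribed derivatives at 0.
   Only nonempty lists are meaningful. *)
Definition is_fundamental (mus : list C) (f : R -> C) : Prop :=
  (forall (k : nat) (x : R), (k < length mus)%nat ->
     ex_derive (V := C_R_NormedModule) (CDerive_n k f) x) /\
  (forall x : R, diff_op mus f x = RtoC 0) /\
  (forall k : nat, (k < pred (length mus))%nat -> CDerive_n k f 0 = RtoC 0) /\
  CDerive_n (pred (length mus)) f 0 = RtoC 1.

(* The solution of the initial value problem exists and is unique for every
   nonempty list, so the choice is determined. *)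
Definition Phi (mus : list C) : R -> C :=
  epsilon (inhabits (fun _ : R => RtoC 0)) (is_fundamental mus).

(* Division in [C] is total; the quotients below are meaningful only where
   their denominators do not vanish. *)
Definition rho (l0 l1 l2 l3 : C) (x : R) : C :=
  ((CDerive (Phi [l0; l1; l2; l3]) x * Phi [l0; l1] x
    - Phi [l0; l1; l2; l3] x * CDerive (Phi [l0; l1]) x)
   / (Phi [l0; l1] x * Phi [l2; l3] x))%C.

Definition sigma (l0 l1 l2 l3 : C) (x : R) : C :=
  (Phi [l0; l1; l2; l3] x / (Phi [l0; l1] x * Phi [l2; l3] x))%C.

(* Entry (i, j) of the tridiagonal matrix for the knots t 1 < ... < t n, with
   the 1-based indexing of the knots; rows are 2 <= i <= n - 1. *)
Definition Rmat (l0 l1 l2 l3 : C) (t : nat -> R) (i j : nat) : C :=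
  if Nat.eqb j i then
    (rho l0 l1 l2 l3 (t i - t (i - 1)%nat)
     - rho l0 l1 l2 l3 (- (t (i + 1)%nat - t i)))%C
  else if Nat.eqb j (i + 1) then sigma l0 l1 l2 l3 (t (i + 1)%nat - t i)
  else if Nat.eqb (j + 1) i then
    (- sigma l0 l1 l2 l3 (- (t i - t (i - 1)%nat)))%C
  else RtoC 0.

(* The usual order on complex numbers: [z <= w] means that [w - z] is a
   nonnegative real. In particular the chain z <= c * w < w with c real,
   c <> 1, forces z and w to be real. *)
Definition Cle (z w : C) : Prop := Re z <= Re w /\ Im z = Im w.
Definition Clt (z w : C) : Prop := Re z < Re w /\ Im z = Im w.

(* Main.v *)
Require Import Defs.
From Stdlib Require Import Reals List Lra Lia ClassicalEpsilon.
From Coquelicot Require Import Coquelicot.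

(** Write [y] for [beta] times a knot gap.  For the given exponents the
    fundamental functions are [x], [sin (beta x) / beta] and
    [(beta x - sin (beta x)) / beta^3], so that, up to a common factor
    [1 / beta],
    [[ rho   = (sin y - y cos y) / (y sin y),
       sigma = (y - sin y)      / (y sin y). ]]
    Both are odd functions, and therefore the row [j] of the matrix is, up to
    that factor, [sigma y1], [rho y1 + rho y2], [sigma y2], with [y1], [y2] the
    scaled gaps on the two sides of [t j], both in [(0, delta]].  Since [rho]
    is positive on [(0, PI)], the whole statement reduces to two facts about
    the quotient [ratio = sigma / rho = (y - sin y) / (sin y - y cos y)]:

    - [ratio] is nondecreasing on [(0, PI)] ([ratio_nondecreasing]), hence
      [sigma y <= ratio delta * rho y] for [y <= delta] ([sigmaR_le]).  With
      [u = y / 2], the sign of the derivative of [ratio] is that of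
      [tan u / u + (sin u / u)^2 - 2], which is Wilker's inequality
      ([wilker]).
    - [ratio < 1] on [(0, PI)] ([ratio_lt_1]), which at the half angle is
      [u < tan u].

    The fundamental functions are specified only as a solution of an initial
    value problem, so the closed forms require its uniqueness
    ([diff_op_unique]).  It is proved by peeling off one factor [d/dx - mu] at
    a time, which reduces it to first order equations; there [|f|^2 exp (-2 Re
    mu x)] is constant for each solution [f] of the homogeneous equation. *)

Import ListNotations.
Open Scope R_scope.

(** * Derivatives of complex-valued functions *)

Lemma ex_derive_C_iff (f : R -> C) (x : R) :
  ex_derive (V := C_R_NormedModule) f x <->
  ex_derive (fun y => Re (f y)) x /\ ex_derive (fun y => Im (f y)) x.
Proof.
  split.
  - intros [l Hl]; split.
    + exists (Re l).
      apply (filterdiff_comp' f (fun z : C_R_NormedModule => Re z) x _ (fun z => Re z) Hl).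
      apply filterdiff_linear, (is_linear_fst (U := R_NormedModule) (V := R_NormedModule)).
    + exists (Im l).
      apply (filterdiff_comp' f (fun z : C_R_NormedModule => Im z) x _ (fun z => Im z) Hl).
      apply filterdiff_linear, (is_linear_snd (U := R_NormedModule) (V := R_NormedModule)).
  - intros [[a Ha] [b Hb]]; exists (a, b).
    apply (filterdiff_ext_locally (fun y => (Re (f y), Im (f y)))).
    { apply filter_forall; intros y; apply eq_sym, surjective_pairing. }
    apply (filterdiff_comp'_2 _ _ (fun u v => (u, v) : C_R_NormedModule) x _ _
             (fun u v => (u, v) : C_R_NormedModule) Ha Hb).
    apply (filterdiff_ext_lin _ (fun t : C_R_NormedModule => t)).
    2: { intros y; apply surjective_pairing. }
    apply (filterdiff_ext_locally (fun t : C_R_NormedModule => t)).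
    { apply filter_forall; intros y; apply surjective_pairing. }
    apply filterdiff_id.
Qed.

Lemma CDerive_ext (f g : R -> C) (x : R) :
  (forall y, f y = g y) -> CDerive f x = CDerive g x.
Proof.
  intros H; unfold CDerive; f_equal; apply Derive_ext; intros y; now rewrite H.
Qed.

Lemma CDerive_n_S (k : nat) (f : R -> C) :
  CDerive_n (S k) f = CDerive_n k (CDerive f).
Proof. apply Nat.iter_succ_r. Qed.

(** The common shape of the real and of the imaginary part of [f - mu * g]. *)
Lemma is_derive_combination (m n : R) (a b c : R -> R) (x : R) :
  ex_derive a x -> ex_derive b x -> ex_derive c x ->
  is_derive (fun y => a y - (m * b y + n * c y)) x
    (Derive a x - (m * Derive b x + n * Derive c x)).
Proof.
  intros Ha Hb Hc; auto_derive; [tauto |].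
  change (fun x : R => a x) with a; change (fun x : R => b x) with b;
  change (fun x : R => c x) with c; ring.
Qed.

Lemma is_derive_step_parts (mu : C) (f g : R -> C) (x : R) :
  ex_derive (V := C_R_NormedModule) f x ->
  ex_derive (V := C_R_NormedModule) g x ->
  is_derive (fun y => Re (f y - mu * g y)%C) x
    (Re (CDerive f x - mu * CDerive g x)%C) /\
  is_derive (fun y => Im (f y - mu * g y)%C) x
    (Im (CDerive f x - mu * CDerive g x)%C).
Proof.
  rewrite !ex_derive_C_iff; intros [Ha Hb] [Hc Hd]; split.
  - replace (Re (CDerive f x - mu * CDerive g x)%C) with
      (Derive (fun y => Re (f y)) x - (Re mu * Derive (fun y => Re (g y)) x
         + - Im mu * Derive (fun y => Im (g y)) x)) by (unfold CDerive, Re, Im; simpl; ring).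
    eapply is_derive_ext; [| apply is_derive_combination; eassumption].
    intros y; unfold Re, Im; simpl; ring.
  - replace (Im (CDerive f x - mu * CDerive g x)%C) with
      (Derive (fun y => Im (f y)) x - (Re mu * Derive (fun y => Im (g y)) x
         + Im mu * Derive (fun y => Re (g y)) x)) by (unfold CDerive, Re, Im; simpl; ring).
    eapply is_derive_ext; [| apply is_derive_combination; eassumption].
    intros y; unfold Re, Im; simpl; ring.
Qed.

Lemma ex_derive_C_step (mu : C) (f g : R -> C) (x : R) :
  ex_derive (V := C_R_NormedModule) f x ->
  ex_derive (V := C_R_NormedModule) g x ->
  ex_derive (V := C_R_NormedModule) (fun y => (f y - mu * g y)%C) x.
Proof.
  intros Hf Hg; apply ex_derive_C_iff.
  destruct (is_derive_step_parts mu f g x Hf Hg); split; eexists; eassumption.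
Qed.

Lemma CDerive_step (mu : C) (f g : R -> C) (x : R) :
  ex_derive (V := C_R_NormedModule) f x ->
  ex_derive (V := C_R_NormedModule) g x ->
  CDerive (fun y => (f y - mu * g y)%C) x = (CDerive f x - mu * CDerive g x)%C.
Proof.
  intros Hf Hg; destruct (is_derive_step_parts mu f g x Hf Hg) as [Hr Hi].
  apply injective_projections; now apply is_derive_unique.
Qed.

(** * Uniqueness for the initial value problem *)

Definition n_differentiable (N : nat) (f : R -> C) : Prop :=
  forall (k : nat) (x : R), (k < N)%nat ->
    ex_derive (V := C_R_NormedModule) (CDerive_n k f) x.

(** Commutation of [d/dx - mu] with the derivatives: it turns the initial data
    of [f] into those of [f' - mu * f]. *)
Lemma CDerive_n_step (mu : C) (f : R -> C) (N k : nat) (x : R) :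
  n_differentiable (S N) f -> (k <= N)%nat ->
  CDerive_n k (fun y => (CDerive f y - mu * f y)%C) x
  = (CDerive_n (S k) f x - mu * CDerive_n k f x)%C.
Proof.
  intros Hf; revert x; induction k as [|k IH]; intros x Hk; [reflexivity|].
  change (CDerive_n (S k) ?g x) with (CDerive (CDerive_n k g) x) at 1.
  rewrite (CDerive_ext _ _ x (fun y => IH y (Nat.lt_le_incl _ _ Hk))).
  apply CDerive_step; apply Hf; lia.
Qed.

Lemma n_differentiable_step (mu : C) (f : R -> C) (N : nat) :
  n_differentiable (S N) f -> n_differentiable N (fun y => (CDerive f y - mu * f y)%C).
Proof.
  intros Hf k x Hk.
  apply (ex_derive_ext (V := C_R_NormedModule)
           (fun y => (CDerive_n (S k) f y - mu * CDerive_n k f y)%C)).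
  { intros y; symmetry; apply (CDerive_n_step _ _ N); [exact Hf | lia]. }
  apply ex_derive_C_step; apply Hf; lia.
Qed.

(** The planar system is [f' = mu * f] for [f = p + i q] and [mu = m + i n].
    The rotation [n] preserves [p^2 + q^2], which thus grows exactly like
    [exp (2 m x)]: the product with [exp (- 2 m x)] is constant, and it
    vanishes at 0. *)
Lemma linear_planar_zero (m n : R) (p q : R -> R) :
  (forall x, is_derive p x (m * p x - n * q x)) ->
  (forall x, is_derive q x (m * q x + n * p x)) ->
  p 0 = 0 -> q 0 = 0 -> forall x, p x = 0 /\ q x = 0.
Proof.
  intros Hp Hq Hp0 Hq0 x.
  set (E := fun y => (p y * p y + q y * q y) * exp (- (2 * m * y))).
  assert (HE : forall y, is_derive E y 0).
  { intros y; unfold E; auto_derive.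
    - repeat split; eexists; [apply Hp | apply Hp | apply Hq | apply Hq].
    - change (fun x : R => p x) with p; change (fun x : R => q x) with q.
      rewrite (is_derive_unique _ _ _ (Hp y)), (is_derive_unique _ _ _ (Hq y)); ring. }
  assert (Hconst : E x = E 0).
  { destruct (Rtotal_order x 0) as [H | [-> | H]]; [| reflexivity |].
    - apply (eq_is_derive E x 0); [intros; apply HE | exact H].
    - symmetry; apply (eq_is_derive E 0 x); [intros; apply HE | exact H]. }
  unfold E in Hconst; rewrite Hp0, Hq0 in Hconst.
  pose proof (exp_pos (- (2 * m * x))) as Hexp.
  assert (p x * p x + q x * q x = 0).
  { apply (Rmult_eq_reg_r (exp (- (2 * m * x)))); lra. }
  split; nra.
Qed.

Lemma first_order_unique (mu : C) (f g : R -> C) :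
  n_differentiable 1 f -> n_differentiable 1 g ->
  (forall x, (CDerive f x - mu * f x)%C = (CDerive g x - mu * g x)%C) ->
  f 0 = g 0 -> forall x, f x = g x.
Proof.
  intros Hf Hg Heq H0.
  assert (Hf' := fun x => proj1 (ex_derive_C_iff f x) (Hf 0%nat x Nat.lt_0_1)).
  assert (Hg' := fun x => proj1 (ex_derive_C_iff g x) (Hg 0%nat x Nat.lt_0_1)).
  assert (Hre := fun x => f_equal Re (Heq x)); assert (Him := fun x => f_equal Im (Heq x)).
  unfold CDerive, Cminus, Cplus, Copp, Cmult, Re, Im in Hre, Him; simpl in Hre, Him.
  unfold Re, Im in Hf', Hg'.
  assert (H : forall x, fst (f x) - fst (g x) = 0 /\ snd (f x) - snd (g x) = 0).
  { apply (linear_planar_zero (fst mu) (snd mu)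
             (fun x => fst (f x) - fst (g x)) (fun x => snd (f x) - snd (g x))).
    - intros x; specialize (Hre x); simpl.
      match goal with |- is_derive _ _ ?d => replace d with
        (Derive (fun y => fst (f y)) x - Derive (fun y => fst (g y)) x) by lra end.
      apply (is_derive_minus (V := R_NormedModule)); apply Derive_correct;
        [apply Hf' | apply Hg'].
    - intros x; specialize (Him x); simpl.
      match goal with |- is_derive _ _ ?d => replace d with
        (Derive (fun y => snd (f y)) x - Derive (fun y => snd (g y)) x) by lra end.
      apply (is_derive_minus (V := R_NormedModule)); apply Derive_correct;
        [apply Hf' | apply Hg'].
    - rewrite H0; ring.
    - rewrite H0; ring. }
  intros x; destruct (H x); apply injective_projections; lra.
Qed.

(** If [f] and [g] agree under the whole operator, then [f' - mu f] and
    [g' - mu g] agree under the remaining factors and have the same initial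
    data; by induction they are equal, and a first order equation remains. *)
Lemma diff_op_unique (mus : list C) (f g : R -> C) :
  n_differentiable (length mus) f -> n_differentiable (length mus) g ->
  (forall x, diff_op mus f x = diff_op mus g x) ->
  (forall k, (k < length mus)%nat -> CDerive_n k f 0 = CDerive_n k g 0) ->
  forall x, f x = g x.
Proof.
  revert f g; induction mus as [|mu l IH]; intros f g Hf Hg Heq H0; [exact Heq|].
  simpl in Hf, Hg, H0.
  apply (first_order_unique mu).
  - intros k x Hk; apply Hf; lia.
  - intros k x Hk; apply Hg; lia.
  - apply IH.
    + apply n_differentiable_step, Hf.
    + apply n_differentiable_step, Hg.
    + exact Heq.
    + intros k Hk; rewrite !(CDerive_n_step _ _ (length l)) by (assumption || lia).
      rewrite !H0 by lia; reflexivity.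
  - apply (H0 0%nat); lia.
Qed.

(** * Closed forms of the fundamental functions *)

(** The differential operator acting on the sequence of the derivatives of a
    function at a point, so that the equation can be checked by algebra. *)
Fixpoint jet_op (mus : list C) (a : nat -> C) : C :=
  match mus with
  | nil => a 0%nat
  | mu :: l => jet_op l (fun k => (a (S k) - mu * a k)%C)
  end.

Lemma jet_op_ext (mus : list C) (a b : nat -> C) :
  (forall k, (k <= length mus)%nat -> a k = b k) -> jet_op mus a = jet_op mus b.
Proof.
  revert a b; induction mus as [|mu l IH]; intros a b H; simpl in *.
  - now apply H.
  - apply IH; intros k Hk; rewrite !H by lia; reflexivity.
Qed.

Lemma diff_op_jet (mus : list C) (f : R -> C) (x : R) :
  n_differentiable (length mus) f ->
  diff_op mus f x = jet_op mus (fun k => CDerive_n k f x).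
Proof.
  revert f; induction mus as [|mu l IH]; intros f Hf; [reflexivity|].
  simpl in *; rewrite IH by now apply n_differentiable_step.
  apply jet_op_ext; intros k Hk; now apply (CDerive_n_step _ _ (length l)).
Qed.

Lemma CDerive_RtoC (f : R -> R) (x : R) :
  CDerive (fun y => RtoC (f y)) x = RtoC (Derive f x).
Proof.
  unfold CDerive, RtoC; simpl; f_equal; apply Derive_const.
Qed.

Lemma CDerive_n_derivatives (N : nat) (a : nat -> R -> R) :
  (forall k x, (k < N)%nat -> is_derive (a k) x (a (S k) x)) ->
  forall k x, (k <= N)%nat ->
  CDerive_n k (fun y => RtoC (a 0%nat y)) x = RtoC (a k x).
Proof.
  intros Ha; induction k as [|k IH]; intros x Hk; [reflexivity|].
  change (CDerive (CDerive_n k (fun y => RtoC (a 0%nat y))) x = RtoC (a (S k) x)).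
  rewrite (CDerive_ext _ _ x (fun y => IH y (Nat.lt_le_incl _ _ Hk))), CDerive_RtoC.
  now rewrite (is_derive_unique _ _ _ (Ha k x Hk)).
Qed.

(** To identify [Phi mus] with a real function [a 0] it suffices to list its
    successive derivatives [a k]: existence of a fundamental function makes
    [Phi mus] one, and uniqueness makes it equal to [a 0]. *)
Lemma Phi_real (mus : list C) (a : nat -> R -> R) :
  mus <> [] ->
  (forall k x, (k < length mus)%nat -> is_derive (a k) x (a (S k) x)) ->
  (forall x, jet_op mus (fun k => RtoC (a k x)) = RtoC 0) ->
  (forall k, (k < pred (length mus))%nat -> a k 0 = 0) ->
  a (pred (length mus)) 0 = 1 ->
  forall x, Phi mus x = RtoC (a 0%nat x).
Proof.
  intros Hne Ha Hode Hk0 HN0.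
  assert (Hlen : (0 < length mus)%nat) by (destruct mus; simpl; [congruence | lia]).
  assert (Hchain := CDerive_n_derivatives (length mus) a Ha).
  assert (Hg : is_fundamental mus (fun y => RtoC (a 0%nat y))).
  { assert (Hs : n_differentiable (length mus) (fun y => RtoC (a 0%nat y))).
    { intros k x Hk.
      apply (ex_derive_ext (V := C_R_NormedModule) (fun y => RtoC (a k y))).
      { intros y; symmetry; apply Hchain; lia. }
      apply ex_derive_C_iff; split; simpl.
      - eexists; now apply Ha.
      - apply ex_derive_const. }
    split; [exact Hs | split; [| split]].
    - intros x; rewrite diff_op_jet by exact Hs.
      rewrite <- (Hode x); apply jet_op_ext; intros k Hk; now apply Hchain.
    - intros k Hk; rewrite Hchain by lia; now rewrite Hk0.
    - rewrite Hchain by lia; now rewrite HN0. }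
  assert (Hf : is_fundamental mus (Phi mus)).
  { unfold Phi; apply epsilon_spec; eexists; exact Hg. }
  destruct Hf as (Hf1 & Hf2 & Hf3 & Hf4), Hg as (Hg1 & Hg2 & Hg3 & Hg4).
  apply (diff_op_unique mus); try assumption.
  - intros x; now rewrite Hf2, Hg2.
  - intros k Hk; destruct (Nat.eq_dec k (pred (length mus))) as [-> | Hne'].
    + now rewrite Hf4, Hg4.
    + rewrite Hf3, Hg3 by lia; reflexivity.
Qed.

Lemma Phi_zero_zero (x : R) : Phi [RtoC 0; RtoC 0] x = RtoC x.
Proof.
  apply (Phi_real _ (fun k => match k with
    | 0%nat => fun x => x
    | 1%nat => fun _ => 1
    | _ => fun _ => 0 end)).
  - discriminate.
  - intros [|[|k]] y Hk; simpl in Hk; try lia; auto_derive; auto; ring.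
  - intros y; simpl; ring.
  - intros [|k] Hk; simpl in Hk; [reflexivity | lia].
  - reflexivity.
Qed.

Lemma Phi_conjugate_pair (beta x : R) : beta <> 0 ->
  Phi [(- (Ci * RtoC beta))%C; (Ci * RtoC beta)%C] x = RtoC (sin (beta * x) / beta).
Proof.
  intros Hb.
  apply (Phi_real _ (fun k => match k with
    | 0%nat => fun x => sin (beta * x) / beta
    | 1%nat => fun x => cos (beta * x)
    | _ => fun x => - beta * sin (beta * x) end)).
  - discriminate.
  - intros [|[|k]] y Hk; simpl in Hk; try lia; auto_derive; auto; field; auto.
  - intros y; apply injective_projections; simpl; field; auto.
  - intros [|k] Hk; simpl in Hk; [| lia]. rewrite Rmult_0_r, sin_0; field; auto.
  - simpl; now rewrite Rmult_0_r, cos_0.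
Qed.

Lemma Phi_zero_zero_conjugate_pair (beta x : R) : beta <> 0 ->
  Phi [RtoC 0; RtoC 0; (- (Ci * RtoC beta))%C; (Ci * RtoC beta)%C] x
  = RtoC ((beta * x - sin (beta * x)) / beta ^ 3).
Proof.
  intros Hb.
  apply (Phi_real _ (fun k => match k with
    | 0%nat => fun x => (beta * x - sin (beta * x)) / beta ^ 3
    | 1%nat => fun x => (1 - cos (beta * x)) / beta ^ 2
    | 2%nat => fun x => sin (beta * x) / beta
    | 3%nat => fun x => cos (beta * x)
    | _ => fun x => - beta * sin (beta * x) end)).
  - discriminate.
  - intros [|[|[|[|k]]]] y Hk; simpl in Hk; try lia; auto_derive; auto; field; auto.
  - intros y; apply injective_projections; simpl; field; auto.
  - intros [|[|[|k]]] Hk; simpl in Hk; try lia;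
      rewrite Rmult_0_r, ?sin_0, ?cos_0; field; auto.
  - simpl; now rewrite Rmult_0_r, cos_0.
Qed.

(** * Closed forms of the matrix entries *)

(** The functions [rho] and [sigma] for [beta = 1]. *)
Definition rhoR (y : R) : R := (sin y - y * cos y) / (y * sin y).
Definition sigmaR (y : R) : R := (y - sin y) / (y * sin y).

Lemma sigma_formula (beta x : R) :
  beta <> 0 -> x <> 0 -> sin (beta * x) <> 0 ->
  Defs.sigma (RtoC 0) (RtoC 0) (- (Ci * RtoC beta))%C (Ci * RtoC beta)%C x
  = RtoC (sigmaR (beta * x) / beta).
Proof.
  intros Hb Hx Hs; unfold Defs.sigma.
  rewrite Phi_zero_zero_conjugate_pair, Phi_zero_zero, Phi_conjugate_pair by exact Hb.
  assert (x * (sin (beta * x) / beta) <> 0).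
  { unfold Rdiv; repeat apply Rmult_integral_contrapositive_currified; auto using Rinv_neq_0_compat. }
  rewrite <- RtoC_mult, <- RtoC_div by assumption.
  f_equal; unfold sigmaR; field; auto.
Qed.

Lemma rho_formula (beta x : R) :
  beta <> 0 -> x <> 0 -> sin (beta * x) <> 0 ->
  rho (RtoC 0) (RtoC 0) (- (Ci * RtoC beta))%C (Ci * RtoC beta)%C x
  = RtoC (rhoR (beta * x) / beta).
Proof.
  intros Hb Hx Hs; unfold rho.
  rewrite (CDerive_ext _ _ x (fun y => Phi_zero_zero_conjugate_pair beta y Hb)).
  rewrite (CDerive_ext _ _ x Phi_zero_zero), !CDerive_RtoC.
  rewrite Phi_zero_zero_conjugate_pair, Phi_zero_zero, Phi_conjugate_pair by exact Hb.
  rewrite (is_derive_unique _ x ((1 - cos (beta * x)) / beta ^ 2))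
    by (auto_derive; auto; field; auto).
  rewrite Derive_id.
  assert (x * (sin (beta * x) / beta) <> 0).
  { unfold Rdiv; repeat apply Rmult_integral_contrapositive_currified; auto using Rinv_neq_0_compat. }
  rewrite <- !RtoC_mult, <- RtoC_minus, <- RtoC_div by assumption.
  f_equal; unfold rhoR; field; auto.
Qed.

Lemma rhoR_odd (y : R) : rhoR (- y) = - rhoR y.
Proof.
  unfold rhoR; rewrite sin_neg, cos_neg.
  replace (- y * - sin y) with (y * sin y) by ring. unfold Rdiv; ring.
Qed.

Lemma sigmaR_odd (y : R) : sigmaR (- y) = - sigmaR y.
Proof.
  unfold sigmaR; rewrite sin_neg.
  replace (- y * - sin y) with (y * sin y) by ring. unfold Rdiv; ring.
Qed.

(** * Trigonometric inequalities *)

Lemma derive_nonneg_le (f f' : R -> R) (a b : R) :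
  a <= b ->
  (forall x, a <= x <= b -> is_derive f x (f' x)) ->
  (forall x, a < x < b -> 0 <= f' x) -> f a <= f b.
Proof.
  intros [Hab | ->] Hd Hpos; [| lra].
  destruct (MVT_cor2 f f' a b Hab) as (c & Hc & Hin).
  { intros c Hc; now apply is_derive_Reals, Hd. }
  specialize (Hpos c Hin); nra.
Qed.

(** Vanishes at 0 and has the derivative [y * sin y]. *)
Lemma sin_minus_cos_pos (y : R) : 0 < y < PI -> 0 < sin y - y * cos y.
Proof.
  intros Hy.
  destruct (MVT_cor2 (fun z => sin z - z * cos z) (fun z => z * sin z) 0 y)
    as (c & Hc & Hin); [lra | |].
  { intros z _; apply is_derive_Reals; auto_derive; auto; ring. }
  rewrite sin_0 in Hc.
  assert (0 < c * sin c).
  { apply Rmult_lt_0_compat; [lra | apply sin_gt_0; lra]. }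
  assert (0 < c * sin c * (y - 0)) by (apply Rmult_lt_0_compat; lra).
  lra.
Qed.

Lemma rhoR_pos (y : R) : 0 < y < PI -> 0 < rhoR y.
Proof.
  intros Hy; apply Rdiv_lt_0_compat; [now apply sin_minus_cos_pos |].
  apply Rmult_lt_0_compat; [lra | apply sin_gt_0; lra].
Qed.

(** The left-hand side vanishes at 0; using [sin^2 = 1 - cos^2] and writing [c]
    for [cos u], its derivative is [2 / c^3] times
    [(c - 1)^2 (2 c^3 + 4 c^2 + 3 c + 1) + (u - sin u) sin u]. *)
Lemma wilker_derivative_nonneg (u : R) : 0 <= u < PI / 2 ->
  0 <= sin u / cos u + u / cos u ^ 2 + 2 * sin u * cos u - 4 * u.
Proof.
  intros Hu.
  pose (h := fun u => sin u / cos u + u / cos u ^ 2 + 2 * sin u * cos u - 4 * u).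
  pose (h' := fun u => (cos u ^ 2 + sin u ^ 2) / cos u ^ 2
                       + (cos u + 2 * u * sin u) / cos u ^ 3
                       + 2 * (cos u ^ 2 - sin u ^ 2) - 4).
  change (0 <= h u); replace 0 with (h 0) at 1
    by (unfold h; rewrite sin_0, cos_0; field).
  apply (derive_nonneg_le h h'); [lra | |].
  - intros x Hx; assert (Hc : 0 < cos x) by (apply cos_gt_0; lra).
    unfold h, h'; auto_derive.
    + repeat split; try lra; apply Rgt_not_eq; nra.
    + field; lra.
  - intros x Hx; assert (Hc : 0 < cos x) by (apply cos_gt_0; lra).
    assert (Hs : 0 < sin x) by (apply sin_gt_0; lra).
    pose proof (sin_lt_x x (proj1 Hx)) as Hsx.
    pose proof (sin2_cos2 x) as H2; unfold Rsqr in H2.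
    replace (h' x) with (2 / cos x ^ 3 *
      ((cos x - 1) ^ 2 * (2 * cos x ^ 3 + 4 * cos x ^ 2 + 3 * cos x + 1)
       + (x - sin x) * sin x)).
    + apply Rmult_le_pos.
      * apply Rlt_le, Rdiv_lt_0_compat; [lra | now apply pow_lt].
      * apply Rplus_le_le_0_compat; [apply Rmult_le_pos; [apply pow2_ge_0 |] |
          apply Rmult_le_pos; lra].
        pose proof (pow_lt _ 3 Hc); pose proof (pow_lt _ 2 Hc); lra.
    + unfold h'; replace (sin x ^ 2) with (1 - cos x ^ 2) by lra.
      replace ((x - sin x) * sin x) with (x * sin x - (1 - cos x ^ 2)) by lra.
      field; lra.
Qed.

(** Wilker's inequality [tan u / u + (sin u / u)^2 >= 2], multiplied by
    [u^2 * cos u].  Divided by [cos u] only, the difference of the two sides is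
    [u tan u + sin^2 u - 2 u^2]; it vanishes at 0 and its derivative is the
    expression of [wilker_derivative_nonneg]. *)
Lemma wilker (u : R) : 0 <= u < PI / 2 ->
  2 * u ^ 2 * cos u <= u * sin u + sin u ^ 2 * cos u.
Proof.
  intros Hu.
  pose (h := fun u => u * sin u / cos u + sin u ^ 2 - 2 * u ^ 2).
  assert (H : 0 <= h u).
  { replace 0 with (h 0) at 1 by (unfold h; rewrite sin_0, cos_0; field).
    apply (derive_nonneg_le h (fun u => sin u / cos u + u * (cos u ^ 2 + sin u ^ 2) / cos u ^ 2 + 2 * sin u * cos u - 4 * u)); [lra | |].
    - intros x Hx; assert (Hc : 0 < cos x) by (apply cos_gt_0; lra).
      unfold h; auto_derive; [lra | field; lra].
    - intros x Hx; assert (Hw := wilker_derivative_nonneg x ltac:(lra)).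
      pose proof (sin2_cos2 x) as H2; unfold Rsqr in H2.
      replace (cos x ^ 2 + sin x ^ 2) with 1 by lra.
      rewrite Rmult_1_r; exact Hw. }
  assert (Hc : 0 < cos u) by (apply cos_gt_0; lra).
  apply (Rmult_le_compat_r (cos u)) in H; [| lra].
  unfold h in H.
  replace ((u * sin u / cos u + sin u ^ 2 - 2 * u ^ 2) * cos u) with
    (u * sin u + sin u ^ 2 * cos u - 2 * u ^ 2 * cos u) in H by (field; lra).
  lra.
Qed.

Definition ratio (y : R) : R := (y - sin y) / (sin y - y * cos y).

(** The numerator of the derivative simplifies to
    [(y + sin y) (1 - cos y) - y^2 sin y], which for [y = 2 u] equals
    [4 sin u (u sin u + sin^2 u cos u - 2 u^2 cos u)]. *)
Lemma ratio_nondecreasing (y z : R) : 0 < y -> y <= z -> z < PI -> ratio y <= ratio z.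
Proof.
  intros Hy Hyz Hz.
  apply (derive_nonneg_le ratio (fun y =>
    ((1 - cos y) * (sin y - y * cos y) - (y - sin y) * (y * sin y))
      / (sin y - y * cos y) ^ 2)); [exact Hyz | |].
  - intros x Hx; pose proof (sin_minus_cos_pos x ltac:(lra)) as HD.
    unfold ratio; auto_derive; [lra | field; lra].
  - intros x Hx; pose proof (sin_minus_cos_pos x ltac:(lra)) as HD.
    apply Rmult_le_pos; [| apply Rlt_le, Rinv_0_lt_compat, pow_lt, HD].
    replace ((1 - cos x) * (sin x - x * cos x) - (x - sin x) * (x * sin x))
      with ((x + sin x) * (1 - cos x) - x ^ 2 * sin x)
      by (pose proof (sin2_cos2 x); unfold Rsqr in *; nra).
    pose proof (wilker (x / 2) ltac:(lra)) as Hw.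
    assert (Hs : 0 < sin (x / 2)) by (apply sin_gt_0; lra).
    replace x with (2 * (x / 2)) by field.
    set (u := x / 2) in *.
    pose proof (sin2_cos2 u) as H2; unfold Rsqr in H2.
    rewrite sin_2a, cos_2a_sin.
    nra.
Qed.

(** For [y = 2 u], the denominator of [ratio] minus its numerator is
    [2 sin y - y (1 + cos y) = 4 cos u (sin u - u cos u)]. *)
Lemma ratio_lt_1 (y : R) : 0 < y < PI -> ratio y < 1.
Proof.
  intros Hy; pose proof (sin_minus_cos_pos y Hy) as HD.
  pose proof (sin_minus_cos_pos (y / 2) ltac:(lra)) as Hh.
  assert (Hc : 0 < cos (y / 2)) by (apply cos_gt_0; lra).
  apply Rmult_lt_reg_r with (sin y - y * cos y); [exact HD |].
  unfold ratio; replace ((y - sin y) / (sin y - y * cos y) * (sin y - y * cos y))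
    with (y - sin y) by (field; lra).
  replace y with (2 * (y / 2)) by field.
  set (u := y / 2) in *; rewrite sin_2a, cos_2a_cos; nra.
Qed.

Lemma sigmaR_le (y delta : R) : 0 < y -> y <= delta -> delta < PI ->
  sigmaR y <= ratio delta * rhoR y.
Proof.
  intros Hy Hyd Hd.
  pose proof (sin_minus_cos_pos y ltac:(lra)) as HD.
  assert (Hs : 0 < sin y) by (apply sin_gt_0; lra).
  assert (Hr := rhoR_pos y ltac:(lra)).
  replace (sigmaR y) with (ratio y * rhoR y)
    by (unfold sigmaR, ratio, rhoR; field; lra).
  apply Rmult_le_compat_r; [lra | now apply ratio_nondecreasing].
Qed.

(** * The matrix inequality *)

Theorem proposition27 (delta beta : R)
    (Hdelta0 : 0 < delta) (HdeltaPI : delta < PI) (Hbeta : 0 < beta)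
    (n : nat) (Hn : (3 <= n)%nat) (t : nat -> R)
    (Ht : forall j : nat, (1 <= j <= n - 1)%nat -> t j < t (j + 1)%nat)
    (Hstep : forall j : nat, (1 <= j <= n - 1)%nat ->
       beta * (t (j + 1)%nat - t j) <= delta)
    (j : nat) (Hj : (2 <= j <= n - 1)%nat) :
  let M := Rmat (RtoC 0) (RtoC 0) (- (Ci * RtoC beta))%C (Ci * RtoC beta)%C t in
  let c := RtoC ((sin delta - delta) / (delta * cos delta - sin delta)) in
  Cle (M j (j - 1)%nat + M j (j + 1)%nat)%C (c * M j j)%C /\
  Clt (c * M j j)%C (M j j).
Proof.
  intros M c.
  assert (Hp1 := Ht (j - 1)%nat ltac:(lia)); assert (Hp2 := Hstep (j - 1)%nat ltac:(lia)).
  replace (j - 1 + 1)%nat with j in Hp1, Hp2 by lia.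
  assert (Hq1 := Ht j ltac:(lia)); assert (Hq2 := Hstep j ltac:(lia)).
  set (h := t j - t (j - 1)%nat) in *; set (k := t (j + 1)%nat - t j) in *.
  assert (Hh : 0 < h) by (unfold h; lra); assert (Hk : 0 < k) by (unfold k; lra).
  assert (Hbh : 0 < beta * h) by nra; assert (Hbk : 0 < beta * k) by nra.
  assert (Hsh : 0 < sin (beta * h)) by (apply sin_gt_0; lra).
  assert (Hsk : 0 < sin (beta * k)) by (apply sin_gt_0; lra).
  assert (Hneg : forall x, beta * - x = - (beta * x)) by (intros; ring).
  assert (E1 : M j (j - 1)%nat = RtoC (sigmaR (beta * h) / beta)).
  { unfold M, Rmat.
    rewrite (proj2 (Nat.eqb_neq (j - 1) j)), (proj2 (Nat.eqb_neq (j - 1) (j + 1))),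
      (proj2 (Nat.eqb_eq (j - 1 + 1) j)) by lia.
    fold h; rewrite sigma_formula; rewrite ?Hneg, ?sin_neg; try lra.
    rewrite sigmaR_odd, <- RtoC_opp; f_equal; field; lra. }
  assert (E2 : M j (j + 1)%nat = RtoC (sigmaR (beta * k) / beta)).
  { unfold M, Rmat.
    rewrite (proj2 (Nat.eqb_neq (j + 1) j)), Nat.eqb_refl by lia.
    fold k; apply sigma_formula; lra. }
  assert (E3 : M j j = RtoC ((rhoR (beta * h) + rhoR (beta * k)) / beta)).
  { unfold M, Rmat; rewrite Nat.eqb_refl; fold h k.
    rewrite !rho_formula; rewrite ?Hneg, ?sin_neg; try lra.
    rewrite rhoR_odd, <- RtoC_minus; f_equal; field; lra. }
  assert (Ec : c = RtoC (ratio delta)).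
  { pose proof (sin_minus_cos_pos delta ltac:(lra)).
    unfold c, ratio; f_equal; field; lra. }
  rewrite E1, E2, E3, Ec, <- RtoC_plus, <- RtoC_mult.
  pose proof (sigmaR_le (beta * h) delta Hbh Hp2 HdeltaPI).
  pose proof (sigmaR_le (beta * k) delta Hbk Hq2 HdeltaPI).
  pose proof (rhoR_pos (beta * h) ltac:(lra)).
  pose proof (rhoR_pos (beta * k) ltac:(lra)).
  pose proof (ratio_lt_1 delta ltac:(lra)).
  pose proof (Rinv_0_lt_compat beta Hbeta).
  split; (split; [simpl; unfold Rdiv | reflexivity]).
  - rewrite <- Rmult_plus_distr_r, <- Rmult_assoc; apply Rmult_le_compat_r; lra.
  - rewrite <- Rmult_assoc; apply Rmult_lt_compat_r; nra.
Qed.
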